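(* Let $(R,M)$ be a strongly primary domain and let $\widehat R$ be its complete integral closure. If $(R : \widehat R) = (0)$, then $\Lambda(R) < \infty$.
   Context: A domain is a commutative integral domain; a monoid is a commutative cancellative semigroup with identity. For a domain $R$, $R^{\bullet}=R\setminus\{0\}$ is its multiplicative monoid; arithmetical notions for $R$ mean those of the monoid $R^\bullet$. For a monoid $H$, $H^\times$ is its unit group, $\mathfrak m = H\setminus H^\times$, and $\mathsf q(H)$ its quotient group. $H$ is strongly primary if $H\ne H^\times$ and for every $a\in\mathfrak m$ there is $n\in\mathbb N=\{1,2,\dots\}$ with $\mathfrak m^n\subseteq aH$, where $\mathfrak m^n$ is the set of products of $n$ elements of $\mathfrak m$. A domain $R$ is strongly primary if $R^\bullet$ is; equivalently, $R$ is local (unique maximal ideal $M$, not necessarily noetherian), not a field, and every nonzero principal ideal contains a power of $M$. ''$(R,M)$'' means that $M$ is the maximal ideal of $R$. Strongly primary monoids are atomic. $\widehat R$ is the set of all $x$ in the quotient field $K$ of $R$ for which there is $c\in R\setminus\{0\}$ with $cx^n\in R$ for all $n\in\mathbb N$. $(R:\widehat R)=\{z\in K : z\widehat R\subseteq R\}$. For $a\in R^\bullet$, $\mathsf L(a)\subseteq\mathbb N_0$ is the set of all $k$ such that $a$ is, up to a unit factor, a product of $k$ atoms (irreducible elements), with $\mathsf L(a)=\{0\}$ for units. $\Lambda(R)=\sup\{\min\mathsf L(a) : a\in R^\bullet\}\in\mathbb N_0\cup\{\infty\}$. *)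

(* Defs.v *)
From HB Require Import structures.
From mathcomp Require Import all_boot all_order all_algebra.
From mathcomp Require Import boolp classical_sets constructive_ereal.

Set Implicit Arguments.
Unset Strict Implicit.
Unset Printing Implicit Defensive.

Import Order.TTheory GRing.Theory Num.Theory.

Local Open Scope classical_set_scope.
Local Open Scope ring_scope.

Section Domain.
Variable R : idomainType.

(* [idealr_closed] includes properness ([1 \notin _]). *)
Definition is_maximal_ideal (M : {pred R}) : Prop :=
  idealr_closed M /\
  forall J : {pred R}, idealr_closed J -> {subset M <= J} -> J =i M.

Definition is_the_maximal_ideal (M : {pred R}) : Prop :=
  is_maximal_ideal M /\ forall N : {pred R}, is_maximal_ideal N -> N =i M.

Definition nonzero_elements : set R := [set a | a != 0].

Definition nonzero_nonunits : set R :=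
  [set a | nonzero_elements a /\ a \isn't a GRing.unit].

(* A^n as a set of n-fold products, not as an ideal power. *)
Definition nfold_products (A : set R) (n : nat) : set R :=
  [set x | exists s : n.-tuple R,
     (forall i : 'I_n, A (tnth s i)) /\ x = \prod_(i < n) tnth s i].

Definition strongly_primary : Prop :=
  nonzero_nonunits !=set0 /\
  forall a, nonzero_nonunits a ->
    exists2 n : nat, (0 < n)%N &
      nfold_products nonzero_nonunits n `<=`
        [set a * h | h in nonzero_elements].

Definition base_ring : set {fraction R} := range (@tofrac R).

Definition complete_integral_closure : set {fraction R} :=
  [set x | exists2 c : R, c != 0 &
     forall n : nat, (0 < n)%N -> base_ring (tofrac c * x ^+ n)].

Definition conductor : set {fraction R} :=
  [set z | forall x, complete_integral_closure x -> base_ring (z * x)].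

Definition atom : set R :=
  [set p | nonzero_nonunits p /\
     forall b c, p = b * c -> b \is a GRing.unit \/ c \is a GRing.unit].

(* For a unit [a] this is [set 0%N], since an atom never divides a unit. *)
Definition lengths (a : R) : set nat :=
  [set k | exists (u : R) (s : k.-tuple R),
     [/\ u \is a GRing.unit, forall i : 'I_k, atom (tnth s i)
       & a = u * \prod_(i < k) tnth s i]].

Definition enat (k : nat) : \bar int := (k%:Z)%:E.

(* The values lie in N_0 with infinity adjoined, seen inside [\bar int]; the
   minimum of the empty set of lengths is +oo. *)
Definition min_length (a : R) : \bar int :=
  infimum +oo%E [set enat k | k in lengths a].

Definition Lambda : \bar int :=
  supremum 0%E [set min_length a | a in nonzero_elements].

End Domain.

Arguments strongly_primary R : clear implicits.
Arguments complete_integral_closure R : clear implicits.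
Arguments conductor R : clear implicits.
Arguments Lambda R : clear implicits.

(* Main.v *)
Require Import Defs.
From mathcomp Require Import all_boot all_order all_algebra.
From mathcomp Require Import boolp classical_sets constructive_ereal.
From mathcomp Require Import zify ring.

(** Fix a nonzero nonunit [f] of [R]. For [z] in the quotient field let [v z]
be the largest integer [j] with [z] in [f ^ j R]; thus [v] is
super-multiplicative, [v (x + y) >= min (v x) (v y)] with equality when
[v x <> v y], and the elements of value 0 are the elements of [R] that [f]
does not divide.

Strong primariness bounds the number of nonunit factors of an element not
divisible by a fixed [a] ([length_le_of_not_dvd]). Every nonzero [b] is
[f ^ j * c] with [c] of value 0, so it is enough to write [f ^ j] as a product
of a bounded number of elements that are not divisible by [f ^ 2].

This is where the vanishing conductor enters. It yields elements [w] such that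
the values of the powers of [w] are bounded below by [v w = - e], where [e] is
as large as desired ([unbounded_denominators]). For [0 < t < e] and
[s = e - t], put [z = 1 - f ^ s * w]. Since [s - e < 0 = v 1], we get
[v z = s - e = - t]. The inverse of [z] is, up to a unit of [R], a partial sum
of the geometric series [1 + f ^ s * w + f ^ (2 * s) * w ^ 2 + ...], in which
the second term alone has the lowest value, so [z ^ -1] has value [- t] too.
Hence [f ^ (2 * t) = (f ^ t * z) * (f ^ t / z)] is a product of two elements of
value 0 ([even_power_split]). As [e] is arbitrary this works for every [t], and
[b] is, up to a unit, the product of at most four elements not divisible by
[f ^ 2]: these two, [c], and possibly one more factor [f] when [j] is odd. *)

Set Implicit Arguments.
Unset Strict Implicit.
Unset Printing Implicit Defensive.

Import Order.TTheory GRing.Theory Num.Theory.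

Local Open Scope classical_set_scope.
Local Open Scope ring_scope.

Definition divides (R : idomainType) (a x : R) : Prop := exists r, x = a * r.

(** * Strongly primary domains *)

Section StronglyPrimary.
Variable R : idomainType.
Implicit Types (a b c f x u : R) (s : seq R) (n k : nat).

Lemma nonzero_nonunitsX f n :
  nonzero_nonunits f -> (0 < n)%N -> nonzero_nonunits (f ^+ n).
Proof.
move=> [/= f0 fU] n0; split; first by rewrite /nonzero_elements /= expf_neq0.
by rewrite unitrX_pos.
Qed.

Lemma nonzero_nonunitsMr a x : nonzero_nonunits a -> x != 0 ->
  nonzero_nonunits (a * x).
Proof.
move=> [/= a0 aU] x0; split; first by rewrite /nonzero_elements /= mulf_neq0.
by rewrite unitrM negb_and aU.
Qed.

Hypothesis spR : strongly_primary R.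

Lemma strongly_primary_prod a : nonzero_nonunits a ->
  exists n, forall s, (n <= size s)%N ->
    (forall x, x \in s -> nonzero_nonunits x) -> divides a (\prod_(x <- s) x).
Proof.
move=> /(spR.2 a)[n _ sub]; exists n => s ns sP.
have sz : size (take n s) == n by rewrite size_takel.
have [|h _ eh] := sub (\prod_(i < n) tnth (Tuple sz) i).
  exists (Tuple sz); split=> // i.
  by apply: sP; apply: (@mem_take n); rewrite -/(tval (Tuple sz)) mem_tnth.
exists (h * \prod_(x <- drop n s) x).
rewrite mulrA eh -(big_tuple _ _ (Tuple sz) xpredT id) /=.
by rewrite -big_cat cat_take_drop.
Qed.

Lemma strongly_primary_expr a f : a != 0 -> nonzero_nonunits f ->
  exists n, divides a (f ^+ n).
Proof.
move=> a0 fP; have [aU|aU] := boolP (a \is a GRing.unit).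
  by exists 0%N; exists a^-1; rewrite divrr.
have [n nP] := strongly_primary_prod (conj a0 aU); exists n.
have := nP (nseq n f); rewrite size_nseq big_nseq iter_mulr mulr1.
by apply=> // x /nseqP[->].
Qed.

(** If both [x] and [1 - x] were nonunits, then [x] would divide a power of
[1 - x], hence would divide 1. *)
Lemma unit_sub_nonunit x : nonzero_nonunits x -> 1 - x \is a GRing.unit.
Proof.
move=> xP; apply/negPn/negP => xU.
have x1 : 1 - x != 0.
  rewrite subr_eq0; apply/eqP => x1.
  by case: xP => _ /=; rewrite -x1 unitr1.
have [n [r er]] := strongly_primary_expr xP.1 (conj x1 xU : nonzero_nonunits _).
case: xP => _ /= /negP; apply; apply/unitrPr.
have := subrX1 (1 - x) n; rewrite er => e.
exists (r + \sum_(i < n) (1 - x) ^+ i).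
by apply/eqP; rewrite mulrDr -subr_eq0 addrAC e; apply/eqP; ring.
Qed.

Lemma expr_not_dvd f b : nonzero_nonunits f -> b != 0 ->
  exists N, forall j, divides (f ^+ j) b -> (j <= N)%N.
Proof.
move=> fP b0; have [f0 fU] := fP.
have [N [r er]] := strongly_primary_expr b0 fP.
exists N => j [h eh]; rewrite leqNgt; apply/negP => jN.
have /(mulfI (expf_neq0 N f0)) e1 :
    f ^+ N * (f * (f ^+ (j - N.+1) * h * r)) = f ^+ N * 1.
  rewrite mulr1 [RHS]er eh -(subnKC jN) exprD addKn exprS.
  by rewrite !mulrA [_ * f]mulrC.
by case/negP: fU; apply/unitrPr; exists (f ^+ (j - N.+1) * h * r).
Qed.

Lemma divide_out_power f b : nonzero_nonunits f -> b != 0 ->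
  exists j c, [/\ b = f ^+ j * c, c != 0 & ~ divides f c].
Proof.
move=> fP b0; have [N NP] := expr_not_dvd fP b0.
pose P j := `[< divides (f ^+ j) b >].
have exP : exists j, P j by exists 0%N; apply/asboolP; exists b; rewrite mul1r.
have ubP j : P j -> (j <= N)%N by move/asboolP/NP.
case: (ex_maxnP exP ubP) => j /asboolP[c ec] jmax.
exists j, c; split=> //; first by apply: contra_neq b0 => c0; rewrite ec c0 mulr0.
move=> [d ed]; have /jmax : P j.+1; last by rewrite ltnn.
by apply/asboolP; exists d; rewrite ec ed exprSr mulrA.
Qed.

End StronglyPrimary.

(** * Lengths *)

Section Lengths.
Variable R : idomainType.
Implicit Types (a b x u : R) (s : seq R) (n k l : nat).

Lemma lengthsP a k : lengths a k <->
  exists u s, [/\ u \is a GRing.unit, forall x, x \in s -> atom x,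
    a = u * \prod_(x <- s) x & size s = k].
Proof.
split=> [[u [s [uU sP ->]]]|[u [s [uU sP -> sk]]]].
  exists u, s; split; rewrite ?size_tuple ?big_tuple //.
  by move=> x /tnthP[i ->].
subst k; exists u, (in_tuple s); split=> //.
  by move=> i; apply: sP; rewrite mem_tnth.
by rewrite -(big_tuple _ _ (in_tuple s) xpredT id).
Qed.

Lemma lengths_unit u : u \is a GRing.unit -> lengths u 0.
Proof. by move=> uU; apply/lengthsP; exists u, [::]; rewrite big_nil mulr1. Qed.

Lemma lengthsM a b k l : lengths a k -> lengths b l -> lengths (a * b) (k + l).
Proof.
move=> /lengthsP[u [s [uU sP -> <-]]] /lengthsP[v [r [vU rP -> <-]]].
apply/lengthsP; exists (u * v), (s ++ r); split.
- by rewrite unitrM uU.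
- by move=> x; rewrite mem_cat => /orP[/sP|/rP].
- by rewrite big_cat mulrACA.
- by rewrite size_cat.
Qed.

(** A factorization of [x] into nonunits with as many factors as possible
consists of atoms, and a factorization with many factors would make [x]
divisible by [a]. *)
Lemma length_le_of_not_dvd a : strongly_primary R -> nonzero_nonunits a ->
  exists n, forall x, x != 0 -> ~ divides a x ->
    exists2 k, (k <= n)%N & lengths x k.
Proof.
move=> spR aP; have [n nP] := strongly_primary_prod spR aP.
exists n => x x0 xa.
have [xU|xU] := boolP (x \is a GRing.unit).
  by exists 0%N => //; apply: lengths_unit.
pose P k := `[< exists s, [/\ forall y, y \in s -> nonzero_nonunits y,
  x = \prod_(y <- s) y & size s = k] >].
have exP : exists k, P k.
  exists 1%N; apply/asboolP; exists [:: x]; split=> //; last by rewrite big_seq1.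
  by move=> y; rewrite inE => /eqP ->.
have ubP k : P k -> (k <= n)%N.
  move=> /asboolP[s [sP ex sk]]; rewrite leqNgt; apply/negP => nk.
  by apply: xa; rewrite ex; apply: nP => //; rewrite sk ltnW.
case: (ex_maxnP exP ubP) => k Pk kmax; exists k; first exact: ubP.
move/asboolP: Pk => [s [sP ex sk]].
apply/lengthsP; exists 1, s; split=> //; rewrite ?unitr1 ?mul1r //.
move=> p ps; split; first exact: sP.
move=> b c pbc.
have [bU|bU] := boolP (b \is a GRing.unit); first by left.
have [cU|cU] := boolP (c \is a GRing.unit); first by right.
have [p0 _] := sP _ ps.
have := p0; rewrite /nonzero_elements /= pbc mulf_eq0 negb_or => /andP[b0 c0].
have /kmax : P k.+1; last by rewrite ltnn.
apply/asboolP; exists [:: b, c & rem p s]; split.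
- move=> y; rewrite !inE => /or3P[/eqP ->|/eqP ->|/mem_rem /sP] //.
- by rewrite ex (big_rem p) //= !big_cons mulrA -pbc.
- by rewrite /= size_rem // sk prednK // -sk; case: (s) ps.
Qed.

End Lengths.

(** * Splitting powers of a nonunit *)

Section BaseRing.
Variable R : idomainType.
Implicit Types (x y : {fraction R}).

Lemma base_ring_tofrac (r : R) : base_ring (tofrac r).
Proof. by exists r. Qed.

Lemma base_ringB x y : base_ring x -> base_ring y -> base_ring (x - y).
Proof. by move=> [a _ <-] [b _ <-]; exists (a - b); rewrite ?tofracB. Qed.

Lemma base_ringD x y : base_ring x -> base_ring y -> base_ring (x + y).
Proof. by move=> [a _ <-] [b _ <-]; exists (a + b); rewrite ?tofracD. Qed.

Lemma base_ringM x y : base_ring x -> base_ring y -> base_ring (x * y).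
Proof. by move=> [a _ <-] [b _ <-]; exists (a * b); rewrite ?tofracM. Qed.

Lemma base_ring_sum n (E : 'I_n -> {fraction R}) :
  (forall i, base_ring (E i)) -> base_ring (\sum_(i < n) E i).
Proof.
move=> EB; apply: big_ind => //; last exact: base_ringD.
by exists 0; rewrite ?tofrac0.
Qed.

Lemma not_divides_base_ring (f p : R) x : f != 0 -> tofrac p = tofrac f * x ->
  ~ base_ring x -> ~ divides f p.
Proof.
move=> f0 px xB [r pr]; apply: xB; exists r => //.
apply: (@mulfI _ (tofrac f)); first by rewrite tofrac_eq0.
by rewrite -px pr tofracM.
Qed.

(** The factors are [f ^ t.+1 * z] and [f ^ t.+1 * S], where
[z = 1 - f ^ s.+1 * w] and where [S] is a partial sum of the geometric series
for [z ^ -1], long enough for [z * S] to lie in [1 + f R]. *)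
Lemma even_power_split (f : R) (w : {fraction R}) t s :
  strongly_primary R -> nonzero_nonunits f ->
  (forall k, base_ring (tofrac f ^+ (t.+1 + s.+1) * w ^+ k)) ->
  ~ base_ring (tofrac f ^+ (t.+1 + s) * w) ->
  exists p q u, [/\ u \is a GRing.unit, f ^+ (t.+1).*2 = u * (p * q),
    ~ divides f p & ~ divides f q].
Proof.
move=> spR fP wB wNB; have [f0 fU] := fP.
set F := tofrac f in wB wNB *.
have FB k : base_ring (F ^+ k) by rewrite -tofracXn; exact: base_ring_tofrac.
have FwB j k : (t.+1 + s.+1 <= j)%N -> base_ring (F ^+ j * w ^+ k).
  by move=> /subnK <-; rewrite exprD -mulrA; apply: base_ringM.
pose X := F ^+ s.+1 * w.
have FX j k : F ^+ j * X ^+ k = F ^+ (j + s.+1 * k) * w ^+ k.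
  by rewrite exprMn -exprM exprD mulrA.
pose K := (t + s).+3.
pose S := \sum_(i < K) X ^+ i.
have zS : (1 - X) * S = 1 - X ^+ K by rewrite -opprB mulNr -subrX1 opprB.
have [g _ gE] : base_ring (F ^+ (s.+1 * K - 1) * w ^+ K).
  by apply: FwB; rewrite /K; nia.
have XK : X ^+ K = tofrac (f * g).
  rewrite tofracM gE mulrA -exprS -[X ^+ K]mul1r -(expr0 F) FX add0n.
  by congr (F ^+ _ * _); rewrite /K; nia.
have uU : 1 - f * g \is a GRing.unit.
  have [->|g0] := eqVneq g 0; first by rewrite mulr0 subr0 unitr1.
  by apply: unit_sub_nonunit => //; apply: nonzero_nonunitsMr.
(* [f ^ t * S] leaves the base ring because of its second term only. *)
have SE : S = 1 + (X + \sum_(i < (t + s).+1) X ^+ i.+2).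
  by rewrite /S /K !big_ord_recl expr0 expr1.
have TB : base_ring (F ^+ t * \sum_(i < (t + s).+1) X ^+ i.+2).
  rewrite mulr_sumr; apply: base_ring_sum => i.
  by rewrite FX; apply: FwB; nia.
have zB : base_ring (F * (F ^+ t * (1 - X))).
  rewrite mulrA -exprS mulrBr mulr1; apply: base_ringB => //.
  by rewrite -[X]expr1 FX; apply: FwB; nia.
have zNB : ~ base_ring (F ^+ t * (1 - X)).
  rewrite mulrBr mulr1 => /(base_ringB (FB t)).
  by rewrite opprB addrC subrK -[X]expr1 FX muln1 addnS -addSn expr1; apply: wNB.
have SB : base_ring (F * (F ^+ t * S)).
  rewrite SE !mulrDr mulr1; apply: base_ringD; first by rewrite -exprS.
  apply: base_ringD; last by apply: base_ringM => //; rewrite -[F]expr1.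
  by rewrite mulrA -exprS -[X]expr1 FX; apply: FwB; nia.
have SNB : ~ base_ring (F ^+ t * S).
  rewrite SE !mulrDr mulr1 addrCA => SB'.
  have := base_ringB SB' (base_ringD (FB t) TB).
  by rewrite addrK -[X]expr1 FX muln1 addnS -addSn expr1; apply: wNB.
have [p _ pE] := zB; have [q _ qE] := SB.
exists p, q, (1 - f * g)^-1; split; rewrite ?unitrV //.
- apply: (canRL (mulKr uU)); apply/eqP.
  rewrite -tofrac_eq tofracM [eqbRHS]tofracM tofracB tofrac1 -XK -zS tofracXn pE qE -/F.
  by apply/eqP; rewrite -addnn exprD exprS; ring.
- exact: not_divides_base_ring pE zNB.
- exact: not_divides_base_ring qE SNB.
Qed.

(** As [f ^ i] is not in the conductor, some [y] in the complete integral
closure has [f ^ i * y] outside [R]. Take [e] least such that [f ^ e] clears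
the denominators of all powers of [y]; the power [w] of [y] that prevents
[e - 1] from doing so has the worst denominator among its own powers. *)
Lemma unbounded_denominators (f : R) i :
  strongly_primary R -> conductor R = [set 0] -> nonzero_nonunits f ->
  exists e (w : {fraction R}), [/\ (i <= e)%N,
    forall k, base_ring (tofrac f ^+ e.+1 * w ^+ k) &
    ~ base_ring (tofrac f ^+ e * w)].
Proof.
move=> spR cond0 fP; have [f0 fU] := fP.
set F := tofrac f.
have FB k : base_ring (F ^+ k) by rewrite -tofracXn; exact: base_ring_tofrac.
have [y [[c c0 cy] yNB]] :
    exists y, complete_integral_closure R y /\ ~ base_ring (F ^+ i * y).
  apply: contrapT => H.
  have : conductor R (F ^+ i).
    by move=> y yC; apply: contrapT => yNB; apply: H; exists y.
  by rewrite cond0 /= => /eqP; apply/negP; rewrite expf_neq0 // tofrac_eq0.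
have [N [r er]] := strongly_primary_expr spR c0 fP.
pose P e := `[< forall k, base_ring (F ^+ e * y ^+ k) >].
have exP : exists e, P e.
  exists N; apply/asboolP => -[|k]; first by rewrite expr0 mulr1.
  rewrite -tofracXn er tofracM mulrAC; apply: base_ringM.
    exact: cy.
  exact: base_ring_tofrac.
case: (ex_minnP exP) => e /asboolP eP emin.
have ie : (i < e)%N.
  rewrite ltnNge; apply/negP => /subnK ei; apply: yNB.
  rewrite -ei exprD -mulrA; apply: base_ringM => //.
  by have := eP 1%N; rewrite expr1.
case: e => // e in eP emin ie *.
have [k kNB] : exists k, ~ base_ring (F ^+ e * y ^+ k).
  apply: contrapT => H; have /emin : P e; last by rewrite ltnn.
  by apply/asboolP => k; apply: contrapT => kNB; apply: H; exists k.
exists e, (y ^+ k); split=> // l.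
by rewrite -exprM.
Qed.

End BaseRing.

(** * Bounding the minimal lengths *)

Lemma bounded_lengths (R : idomainType) :
  strongly_primary R -> conductor R = [set 0] ->
  exists B, forall b : R, b != 0 -> exists2 k, (k <= B)%N & lengths b k.
Proof.
move=> spR cond0; have [[f fP] _] := spR; have [f0 fU] := fP.
have [n nP] := length_le_of_not_dvd spR (nonzero_nonunitsX fP (ltn0Sn 1)).
exists (4 * n)%N => b b0.
have [j [c [bE c0 cf]]] := divide_out_power spR fP b0.
have f2 x : ~ divides f x -> ~ divides (f ^+ 2) x.
  by move=> xf [r xr]; apply: xf; exists (f * r); rewrite xr expr2 mulrA.
have [kc kcn kcP] := nP c c0 (f2 _ cf).
have [ko kon koP] : exists2 k, (k <= n)%N & lengths (f ^+ odd j) k.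
  case: (odd j); last by exists 0%N => //; apply/lengths_unit/unitr1.
  apply: nP => // -[r fr]; case/negP: fU; apply/unitrPr; exists r.
  by apply: (mulfI f0); rewrite mulr1 mulrA -expr2 -fr.
have [ke ken keP] : exists2 k, (k <= 2 * n)%N & lengths (f ^+ j./2.*2) k.
  case: j./2 => [|t]; first by exists 0%N => //; apply/lengths_unit/unitr1.
  have [e [w [te wB wNB]]] := unbounded_denominators t.+1 spR cond0 fP.
  have [||p [q [u [uU fE pf qf]]]] := @even_power_split R f w t (e - t.+1) spR fP.
  - by rewrite addnS subnKC.
  - by rewrite subnKC.
  have := expf_neq0 (t.+1).*2 f0; rewrite fE !mulf_eq0 !negb_or.
  case/and3P=> _ p0 q0.
  have [kp kpn kpP] := nP p p0 (f2 _ pf); have [kq kqn kqP] := nP q q0 (f2 _ qf).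
  exists (0 + (kp + kq))%N; first by lia.
  by apply: (@lengthsM _ _ _ 0); [exact: lengths_unit | exact: lengthsM].
exists (ko + ke + kc)%N; first by lia.
by rewrite bE -(odd_double_half j) exprD; apply: lengthsM => //; apply: lengthsM.
Qed.

Lemma min_length_le (R : idomainType) (b : R) k :
  lengths b k -> (min_length b <= enat k)%E.
Proof.
move=> bk; rewrite /min_length /infimum.
case: eqP => [e0|_].
  suff : ([set enat k | k in lengths b] (enat k)) by rewrite e0.
  by exists k.
(* The infimum of a nonempty set of lengths is attained, at the least one. *)
have exP : exists k, `[< lengths b k >] by exists k; apply/asboolP.
case: (ex_minnP exP) => m /asboolP bm mmin.
have inf_m : infimums [set enat k | k in lengths b] (enat m).
  split=> [_ [l bl <-]|y]; last by apply; exists m.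
  by rewrite /enat lee_fin lez_nat; apply/mmin/asboolP.
case: xgetP => [y _ [lb _]|/(_ (enat m)) //].
by apply: lb; exists k.
Qed.

Theorem theorem3p7 (R : idomainType) (M : {pred R}) :
  is_the_maximal_ideal M ->
  strongly_primary R ->
  conductor R = [set 0] ->
  (Lambda R < +oo)%E.
Proof.
move=> _ spR cond0; have [B BP] := bounded_lengths spR cond0.
rewrite /Lambda /supremum; case: ifP => // _.
case: xgetP => [y _ [_ least]|//].
apply: (@le_lt_trans _ _ (enat B)); last by rewrite /enat ltey.
apply: least => _ [b b0 <-]; have [k kB bk] := BP b b0.
by apply: (le_trans (min_length_le bk)); rewrite /enat lee_fin lez_nat.
Qed.
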